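(* Let $\Psi$ be a stationary point process on $\mathbb{R}^d$ and let $\Phi:=\mathbb{Z}^d+U$, where $U$ is a $[0,1)^d$-valued random variable independent of $\Psi$. Assume that there are $c>0$ and $\theta\in[0,1)$ such that for each $n\in\mathbb{N}$ the $n$-th correlation function of $\Psi$ exists and is bounded by $n^{\theta n}c^n$. Then $(\Phi,\Psi)$ almost surely does not contain an infinite descending chain.
   Context: A point process is a random locally finite subset of $\mathbb{R}^d$; it is stationary if $\Psi+x$ has the same distribution as $\Psi$ for all $x\in\mathbb{R}^d$. The $n$-th correlation function of $\Psi$ is the Lebesgue density on $(\mathbb{R}^d)^n$ of the measure $\mathbb{E}\sum^{\neq}_{x_1,\dots,x_n\in\Psi}\delta_{(x_1,\dots,x_n)}$ (sum over pairwise distinct points). Let $\varphi,\psi\subset\mathbb{R}^d$ be locally finite and $\|\cdot\|$ the Euclidean norm. A point $p\in\varphi$ prefers $x\in\psi$ to $y\in\psi$ if $\|x-p\|<\|y-p\|$, or if $\|x-p\|=\|y-p\|$ and $x$ is lexicographically strictly smaller than $y$. A point $x\in\psi$ prefers $p\in\varphi$ to $q\in\varphi$ if $\|p-x\|<\|q-x\|$, or if $\|p-x\|=\|q-x\|$ and $p$ is lexicographically strictly greater than $q$. An infinite descending chain in $(\varphi,\psi)$ is an infinite sequence $(z_1,z_2,\dots)$ with $z_i\in\varphi$ for odd $i$, $z_i\in\psi$ for even $i$, such that $z_i$ prefers $z_{i+1}$ to $z_{i-1}$ for all $i\ge2$. *)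

(* Defs.v *)
From HB Require Import structures.
From mathcomp Require Import all_boot all_order all_algebra.
From mathcomp Require Import all_classical all_reals all_analysis measurable_realfun.

Set Implicit Arguments.
Unset Strict Implicit.
Unset Printing Implicit Defensive.

Import Order.TTheory GRing.Theory Num.Theory.
Import numFieldNormedType.Exports.

Local Open Scope classical_set_scope.
Local Open Scope ring_scope.

(* Points of R^d are d.-tuples over R: these carry the product (= Borel)
   sigma-algebra, and (R^d)^n is n.-tuple (d.-tuple R). *)

(* power_measure mu n is the n-fold product of mu, on n-tuples. *)
Section power_measure.
Context d (T : measurableType d) (R : realType).
Variable mu : {sigma_finite_measure set T -> \bar R}.

Definition pcons n (p : T * n.-tuple T) : n.+1.-tuple T := [tuple of p.1 :: p.2].

Definition puncons n (t : n.+1.-tuple T) : T * n.-tuple T :=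
  (thead t, [tuple of behead t]).

Lemma pconsK n : cancel (@pcons n) (@puncons n).
Proof.
by case=> x t; rewrite /puncons /pcons /= theadE; congr (_, _); exact: val_inj.
Qed.

Lemma measurable_pcons n : measurable_fun [set: T * n.-tuple T] (@pcons n).
Proof. by apply: measurable_cons. Qed.

Lemma measurable_puncons n : measurable_fun [set: n.+1.-tuple T] (@puncons n).
Proof.
apply: measurable_fun_pair => /=.
  exact: (@measurable_tnth _ T n.+1 ord0).
exact: measurable_behead.
Qed.

Section step.
Variables (n : nat) (nu : {sigma_finite_measure set (n.-tuple T) -> \bar R}).

Definition power_step : set (n.+1.-tuple T) -> \bar R :=
  pushforward (mu \x nu)%E (@pcons n).

Let power_step0 : power_step set0 = 0%E.
Proof. by rewrite /power_step /pushforward preimage_set0 measure0. Qed.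

Let power_step_ge0 A : (0 <= power_step A)%E.
Proof. by rewrite /power_step /pushforward measure_ge0. Qed.

Let power_step_sigma_additive : semi_sigma_additive power_step.
Proof.
exact: (@measure_semi_sigma_additive _ _ _
  (measure_function_pushforward__canonical__measure_function_Measure
     (mu \x nu)%E (@measurable_pcons n))).
Qed.

HB.instance Definition _ := isMeasure.Build _ _ _ power_step
  power_step0 power_step_ge0 power_step_sigma_additive.

Let power_step_sigma_finite : sigma_finite setT power_step.
Proof.
have /sigma_finiteP[F [TF ndF Foo]] := sigma_finiteT mu.
have /sigma_finiteP[G [TG ndG Goo]] := sigma_finiteT nu.
exists (fun k => @puncons n @^-1` (F k `*` G k)).
  rewrite -preimage_bigcup (_ : \bigcup_i _ = setT) ?preimage_setT//.
  rewrite -setXTT TF TG predeqE => -[x y]; split.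
    by move=> [k _ []/= ? ?]; split; exists k.
  move=> [/= [k _ Fx] [l _ Gy]]; exists (maxn k l) => //; split.
    by move: x Fx; exact/subsetPset/ndF/leq_maxl.
  by move: y Gy; exact/subsetPset/ndG/leq_maxr.
move=> k; have [? ?] := Foo k; have [? ?] := Goo k; split.
  by rewrite -[_ @^-1` _]setTI; apply: measurable_puncons => //;
    exact: measurableX.
rewrite /power_step /pushforward -comp_preimage (_ : _ \o _ = id); last first.
  by apply/funext => p /=; exact: pconsK.
by rewrite /= product_measure1E// lte_mul_pinfty// ge0_fin_numE.
Qed.

HB.instance Definition _ :=
  @Measure_isSigmaFinite.Build _ _ _ power_step power_step_sigma_finite.

End step.

Fixpoint power_measure n : {sigma_finite_measure set (n.-tuple T) -> \bar R} :=
  match n with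
  | 0 => @dirac _ (0.-tuple T) [tuple] R
  | m.+1 => power_step (power_measure m)
  end.

End power_measure.

Section lebesgue_power.
Variable R : realType.

(* lebesgue_measure is declared on the alias measurableTypeR R. *)
Definition lebesgueR (A : set R) : \bar R := lebesgue_measure A.

Let lebesgueR0 : lebesgueR set0 = 0%E.
Proof. exact: measure0. Qed.

Let lebesgueR_ge0 A : (0 <= lebesgueR A)%E.
Proof. exact: measure_ge0. Qed.

Let lebesgueR_sigma_additive : semi_sigma_additive lebesgueR.
Proof. exact: (@measure_semi_sigma_additive _ _ _ (@lebesgue_measure R)). Qed.

HB.instance Definition _ := isMeasure.Build _ _ _ lebesgueR
  lebesgueR0 lebesgueR_ge0 lebesgueR_sigma_additive.

Let lebesgueR_sigma_finite : sigma_finite setT lebesgueR.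
Proof. exact: (sigma_finiteT (@lebesgue_measure R)). Qed.

HB.instance Definition _ :=
  @Measure_isSigmaFinite.Build _ _ _ lebesgueR lebesgueR_sigma_finite.

Definition lebesgue_Rd d : {sigma_finite_measure set (d.-tuple R) -> \bar R} :=
  power_measure lebesgueR d.

Definition lebesgue_Rdn d n :
    {sigma_finite_measure set (n.-tuple (d.-tuple R)) -> \bar R} :=
  power_measure (lebesgue_Rd d) n.

End lebesgue_power.

Section geometry.
Context {R : realType} {d : nat}.
Implicit Types (x y p q : d.-tuple R) (phi psi : set (d.-tuple R)).

Definition addt x y : d.-tuple R := [tuple tnth x i + tnth y i | i < d].

Definition edist x y : R :=
  Num.sqrt (\sum_(i < d) (tnth x i - tnth y i) ^+ 2).

Definition origin : d.-tuple R := [tuple 0 | i < d].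

Definition locally_finite phi : Prop :=
  forall r : R, finite_set (phi `&` [set x | edist x origin <= r]).

Definition translate x phi : set (d.-tuple R) := addt x @` phi.

Definition lex_lt x y : bool :=
  ((x : d.-tuplelexi R) < (y : d.-tuplelexi R))%O.

(* p is in the first set, x and y in the second. *)
Definition prefers1 p x y : Prop :=
  edist x p < edist y p \/ (edist x p = edist y p /\ lex_lt x y).

(* x is in the second set, p and q in the first; ties are broken in the
   opposite lexicographic direction. *)
Definition prefers2 x p q : Prop :=
  edist p x < edist q x \/ (edist p x = edist q x /\ lex_lt q p).

(* Chains are indexed from 1; the value z 0 is irrelevant. *)
Definition infinite_descending_chain phi psi (z : nat -> d.-tuple R) : Prop :=
  (forall i, (1 <= i)%N -> if odd i then phi (z i) else psi (z i)) /\
  (forall i, (2 <= i)%N ->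
     if odd i then prefers1 (z i) (z i.+1) (z i.-1)
     else prefers2 (z i) (z i.+1) (z i.-1)).

Definition shifted_lattice (u : d.-tuple R) : set (d.-tuple R) :=
  [set addt [tuple (tnth k i)%:~R | i < d] u | k in [set: d.-tuple int]].

End geometry.

Section point_processes.
Variables (R : realType) (d : nat).

(* The sigma-algebra on configurations is the smallest one making all the
   counting maps phi |-> #(phi `&` B), B Borel, measurable. *)
Definition counting_events : set (set (set (d.-tuple R))) :=
  [set S | exists (B : set (d.-tuple R)) (C : set (\bar R)),
     [/\ measurable B, measurable C &
         S = [set phi | C (counting (phi `&` B))]]].

Definition configuration := g_sigma_algebraType counting_events.

Context dO (Omega : measurableType dO) (P : probability Omega R).

Definition point_process (Psi : {RV P >-> configuration}) : Prop :=
  forall w, locally_finite (Psi w).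

Definition stationary (Psi : {RV P >-> configuration}) : Prop :=
  forall (x : d.-tuple R) (A : set configuration), measurable A ->
    P ((fun w => translate x (Psi w)) @^-1` A) = P (Psi @^-1` A).

Definition distinct_tuples n (phi : set (d.-tuple R)) :
    set (n.-tuple (d.-tuple R)) :=
  [set x : n.-tuple (d.-tuple R) | uniq x /\ forall i, phi (tnth x i)].

(* rho is a density with respect to Lebesgue measure on (R^d)^n of the
   expected number of n-tuples of pairwise distinct points. *)
Definition correlation_function (Psi : {RV P >-> configuration}) n
    (rho : n.-tuple (d.-tuple R) -> \bar R) : Prop :=
  [/\ measurable_fun [set: n.-tuple (d.-tuple R)] rho,
      forall x, (0 <= rho x)%E &
      forall B : set (n.-tuple (d.-tuple R)), measurable B ->
        (\int[P]_w counting (distinct_tuples (Psi w) `&` B) =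
         \int[@lebesgue_Rdn R d n]_(x in B) rho x)%E].

End point_processes.

Definition independent_RV (R : realType) dO (Omega : measurableType dO)
    (P : probability Omega R) d1 d2 (T1 : measurableType d1)
    (T2 : measurableType d2) (X : {RV P >-> T1}) (Y : {RV P >-> T2}) : Prop :=
  forall (A : set T1) (B : set T2), measurable A -> measurable B ->
    P (X @^-1` A `&` Y @^-1` B) = (P (X @^-1` A) * P (Y @^-1` B))%E.

(* Main.v *)
(* First moment method. Distances along a descending chain are nonincreasing,
   and an edge cannot be traversed twice, because ties are broken
   monotonically; as edges of bounded length form a locally finite graph, loop
   erasure turns an infinite chain into one whose points x_1, x_2, ... of Psi
   are distinct. For a fixed starting lattice point and a bound M on the first
   distance, consider the first n of them. There are exponentially many choices
   for the successive differences of lattice points. Rounding U to a mesh of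
   size 1/(n d) (polynomially many cells) and
   the nonincreasing distances |x_l - q_l| <= M to multiples of 1/n (at most
   2^(n + n M) monotone sequences), each x_l is confined to a spherical shell of
   thickness 3/n, of volume at most A/n. By the bound on the n-th correlation
   function each choice has probability at most n^(theta n) c^n (A/n)^n, so the
   total is n^d (C n^theta / n)^n up to a constant, which tends to 0 since
   theta < 1. *)
Require Import Defs.
From HB Require Import structures.
From mathcomp Require Import all_boot all_order all_algebra.
From mathcomp Require Import all_classical all_reals all_analysis measurable_realfun.

From mathcomp Require Import ring lra zify.
Import Order.TTheory GRing.Theory Num.Theory.
Import numFieldNormedType.Exports.

Local Open Scope classical_set_scope.
Local Open Scope ring_scope.

(* [edist] alone would denote MathComp-Analysis' extended distance. *)
Local Notation edist := Defs.edist.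

(** * Product measures: boxes and one-dimensional sections *)

Lemma measurable_tuple_box {d} {T : measurableType d} {n} {B : 'I_n -> set T} :
  (forall i, measurable (B i)) ->
  measurable [set x : n.-tuple T | forall i, B i (tnth x i)].
Proof.
move=> mB; rewrite (_ : [set x | _] =
    \bigcap_(i in [set: 'I_n]) ((@tnth n T)^~ i @^-1` B i)).
  apply: fin_bigcap_measurable => // i _; rewrite -[X in measurable X]setTI.
  exact: measurable_tnth.
by apply/seteqP; split => [x h i _|x h i]; exact: h.
Qed.

Lemma le_integral_bounded_indic {d} {T : measurableType d} {R : realType}
    (mu : {measure set T -> \bar R}) {S : set T} {f : T -> \bar R} {c : R} :
  measurable S -> measurable_fun setT f -> 0 <= c ->
  (forall x, 0 <= f x)%E -> (forall x, S x -> f x <= c%:E)%E ->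
  (forall x, ~ S x -> f x = 0)%E ->
  (\int[mu]_x f x <= c%:E * mu S)%E.
Proof.
move=> mS mf c0 f0 fc fS.
have m1 : measurable_fun setT (fun x => (\1_S x)%:E : \bar R).
  by apply/measurable_EFinP; exact: measurable_indic.
rewrite -[in leRHS](setIT S) -(integral_indic mu measurableT mS).
rewrite -ge0_integralZl ?lee_fin//.
apply: ge0_le_integral => //.
  by apply: measurable_funeM.
move=> x _; rewrite indicE; have [/set_mem Sx|/negP Sx] := boolP (x \in S).
  by rewrite mule1 fc.
by rewrite fS ?mule0// => Sx'; apply: Sx; exact/mem_set.
Qed.

Definition set_tnth {T n} (x : n.-tuple T) (i : 'I_n) (t : T) : n.-tuple T :=
  [tuple if j == i then t else tnth x j | j < n].

Lemma set_tnth_ord0 {d} {T : measurableType d} {n} (t s : T) (y : n.-tuple T) :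
  set_tnth (pcons (t, y)) ord0 s = pcons (s, y).
Proof.
apply: eq_from_tnth => j; rewrite tnth_mktuple /pcons /=.
by case: (unliftP ord0 j) => [k ->|->]; rewrite ?tnthS ?tnth0.
Qed.

Lemma set_tnth_lift {d} {T : measurableType d} {n} (t s : T) (y : n.-tuple T) (i : 'I_n) :
  set_tnth (pcons (t, y)) (lift ord0 i) s = pcons (t, set_tnth y i s).
Proof.
apply: eq_from_tnth => j; rewrite tnth_mktuple /pcons /=.
case: (unliftP ord0 j) => [k ->|->]; rewrite ?tnthS ?tnth0//.
by rewrite (inj_eq (@lift_inj _ ord0)) tnth_mktuple.
Qed.

Section power_measure_bounds.
Context {d} {T : measurableType d} {R : realType}.
Context (mu : {sigma_finite_measure set T -> \bar R}).

Lemma power_measure_box_le {n} (B : 'I_n -> set T) (b : R) :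
  (forall i, measurable (B i)) -> (forall i, mu (B i) <= b%:E)%E ->
  (power_measure mu n [set x | forall i, B i (tnth x i)] <= (b ^+ n)%:E)%E.
Proof.
elim: n B => [|n IH] B mB muB.
  rewrite expr0 /= diracE lee_fin; by case: (_ \in _).
have -> : power_measure mu n.+1 [set x | forall i, B i (tnth x i)] =
    (mu \x power_measure mu n)%E
      (B ord0 `*` [set y | forall i, B (lift ord0 i) (tnth y i)]).
  rewrite /= /power_step /pushforward; congr (product_measure1 _ _ _).
  apply/seteqP; split => -[t y] /=.
    move=> h; split; first by have := h ord0; rewrite tnth0.
    by move=> i; have := h (lift ord0 i); rewrite tnthS.
  move=> [h0 h] i.
  by case: (unliftP ord0 i) => [k ->|->]; rewrite ?tnthS ?tnth0.
rewrite product_measure1E//; last first.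
  exact: (measurable_tuple_box (fun i => mB (lift ord0 i))).
rewrite exprS EFinM; apply: lee_pmul => //; first exact: muB.
by apply: (IH (fun i => B (lift ord0 i))) => i; [exact: mB|exact: muB].
Qed.

Lemma measurable_preimage_pcons {n} {A : set (n.+1.-tuple T)} :
  measurable A -> measurable (@pcons _ T n @^-1` A).
Proof.
by move=> mA; rewrite -[X in measurable X]setTI; exact: measurable_pcons.
Qed.

(** Fubini, peeling off the first coordinate: if [i] is a later one, the sections satisfy the
    induction hypothesis; if [i] is the first one, it is integrated first and a box remains. *)
Lemma power_measure_section_le {n} (B : 'I_n -> set T) (b e : R) (i : 'I_n)
    (A : set (n.-tuple T)) :
  0 <= b -> 0 <= e -> measurable A ->
  (forall j, measurable (B j)) -> (forall j, mu (B j) <= b%:E)%E ->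
  (forall x, A x -> forall j, B j (tnth x j)) ->
  (forall x, mu [set t | A (set_tnth x i t)] <= e%:E)%E ->
  (power_measure mu n A <= (b ^+ n.-1 * e)%:E)%E.
Proof.
move=> b0 e0; elim: n B i A => [B []//|n IH] B i A mA mB muB AB Ae.
have mC := measurable_preimage_pcons mA; set C := _ @^-1` _ in mC.
rewrite [X in (X <= _)%E](_ : _ = (mu \x power_measure mu n)%E C)//.
case: (unliftP ord0 i) Ae => [k ->|->] Ae.
  apply: (@le_trans _ _ ((b ^+ n.-1 * e)%:E * mu (B ord0))%E).
    apply: (le_integral_bounded_indic _ (mB ord0)).
    - exact: measurable_fun_xsection.
    - by rewrite mulr_ge0// exprn_ge0.
    - by move=> x; exact: measure_ge0.
    - move=> t _ /=.
      apply: (IH (fun j => B (lift ord0 j)) k) => //.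
      + exact: measurable_xsection.
      + move=> y; rewrite /xsection /= => /set_mem /AB h j.
        by have := h (lift ord0 j); rewrite tnthS.
      + move=> y; apply: le_trans (Ae (pcons (t, y))).
        rewrite le_eqVlt; apply/orP; left; apply/eqP; congr (mu _).
        apply/seteqP; split => s /=; rewrite /xsection /= set_tnth_lift.
          by move/set_mem.
        by move=> ?; apply/mem_set.
    - move=> t Bt /=; rewrite (_ : xsection _ _ = set0) ?measure0//.
      apply/seteqP; split => y //; rewrite /xsection /= => /set_mem /AB.
      by move=> /(_ ord0); rewrite tnth0.
  (* The index [k] shows that [n] is positive, so the factor [b] raises the exponent from [n.-1] to
     [n]. *)
  rewrite -[in leRHS](prednK (leq_ltn_trans (leq0n k) (ltn_ord k))) /=.
  apply: (@le_trans _ _ ((b ^+ n.-1 * e)%:E * b%:E)%E).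
    by rewrite lee_wpmul2l// lee_fin mulr_ge0// exprn_ge0.
  by rewrite -EFinM lee_fin mulrAC -exprSr.
have mB' : measurable [set y : n.-tuple T | forall j, B (lift ord0 j) (tnth y j)].
  exact: (measurable_tuple_box (fun j => mB (lift ord0 j))).
(* Uniqueness of the product measure exchanges the order of integration. *)
rewrite (@product_measure_unique _ _ _ _ _ _ _ (mu \x^ power_measure mu n)%E)//;
  last by move=> ? ? ? ?; exact: product_measure2E.
apply: (@le_trans _ _ (e%:E * power_measure mu n
    [set y | forall j, B (lift ord0 j) (tnth y j)])%E).
  apply: (le_integral_bounded_indic _ mB').
  - exact: measurable_fun_ysection.
  - by [].
  - by move=> x; exact: measure_ge0.
  - move=> y _ /=.
    (* [Ae] requires a full tuple: a point of the section supplies the first entry, which [set_tnth]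
       overwrites; an empty section has measure 0. *)
    have [->|/set0P[t0 _]] := eqVneq (ysection C y) set0.
      by rewrite measure0 lee_fin.
    apply: le_trans (Ae (pcons (t0, y))).
    rewrite le_eqVlt; apply/orP; left; apply/eqP; congr (mu _).
    apply/seteqP; split => s /=; rewrite /ysection /= set_tnth_ord0.
      by move/set_mem.
    by move=> ?; apply/mem_set.
  - move=> y By /=; rewrite (_ : ysection _ _ = set0) ?measure0//.
    apply/seteqP; split => t //; rewrite /ysection /= => /set_mem /AB h.
    by apply: By => j /=; have := h (lift ord0 j); rewrite tnthS.
rewrite [in leRHS]mulrC EFinM lee_wpmul2l ?lee_fin//.
apply: (@power_measure_box_le _ (fun j => B (lift ord0 j))) => j.
  exact: mB.
exact: muB.
Qed.

End power_measure_bounds.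

Lemma measure_fin_bigcup_le {d} {T : measurableType d} {R : realType}
    (mu : {measure set T -> \bar R}) {I : finType} {F : I -> set T} {e : R} :
  (forall i, measurable (F i)) -> (forall i, mu (F i) <= e%:E)%E ->
  (mu (\bigcup_i F i) <= (#|I|%:R * e)%:E)%E.
Proof.
move=> mF muF.
suff h (s : seq I) : measurable (\big[setU/set0]_(i <- s) F i) /\
    (mu (\big[setU/set0]_(i <- s) F i) <= ((size s)%:R * e)%:E)%E.
  rewrite cardT (_ : \bigcup_i F i = \big[setU/set0]_(i <- enum I) F i).
    by have [] := h (enum I).
  by rewrite -bigcup_seq; congr bigcup; apply/seteqP; split => i //= _;
    rewrite mem_enum.
elim: s => [|i s [mU muU]]; first by rewrite big_nil measure0 mul0r.
rewrite big_cons; split; first exact: measurableU.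
apply: le_trans (measureU2 _ (mF i) mU) _.
by rewrite /= -addn1 natrD mulrDl mul1r addrC EFinD leeD.
Qed.

(** * Volume of thin spherical shells *)

Section shells.
Context {R : realType} {d : nat}.
Implicit Types (q x : d.-tuple R) (r eta a b : R).

Lemma edist_ge0 x q : 0 <= edist x q.
Proof. exact: sqrtr_ge0. Qed.

Lemma sqr_edist x q : edist x q ^+ 2 = \sum_(i < d) (tnth x i - tnth q i) ^+ 2.
Proof. by rewrite sqr_sqrtr// sumr_ge0// => i _; exact: sqr_ge0. Qed.

Lemma norm_coord_le_edist x q i : `|tnth x i - tnth q i| <= edist x q.
Proof.
rewrite -(@ler_pXn2r _ 2)// ?nnegrE ?edist_ge0// real_normK ?num_real//.
rewrite sqr_edist (bigD1 i)//= lerDl sumr_ge0// => j _; exact: sqr_ge0.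
Qed.

Lemma measurable_edist q : measurable_fun setT (fun x => edist x q).
Proof.
apply: (@measurableT_comp _ _ _ _ _ _ (@Num.sqrt R)).
  by apply: continuous_measurable_fun; exact: sqrt_continuous.
apply: measurable_sum => i; apply: measurable_funX.
apply: measurable_funB => //; exact: measurable_tnth.
Qed.

Definition shell q a b : set (d.-tuple R) := [set x | a <= edist x q <= b].

Lemma measurable_shell q a b : measurable (shell q a b).
Proof.
rewrite (_ : shell q a b = (fun x => edist x q) @^-1` `[a, b]); last first.
  by apply/seteqP; split => x; rewrite /shell /= in_itv.
by rewrite -[X in measurable X]setTI; exact: measurable_edist.
Qed.

(** Cutting at [c] leaves two pieces of diameter at most [L], each inside an interval of length
    [2 * L] about any of its points. The pieces will be the two crossings of a line with a shell. *)
Lemma lebesgueR_diam_le (c L : R) (S : set R) : 0 <= L -> measurable S ->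
  (forall t u, S t -> S u -> (c <= t) = (c <= u) -> `|t - u| <= L) ->
  (lebesgueR S <= (4 * L)%:E)%E.
Proof.
move=> L0 mS diamS.
have cover (U : set R) : (forall t u, U t -> U u -> `|t - u| <= L) ->
    exists s, U `<=` `[s - L, s + L].
  move=> hU; have [->|/set0P[s Us]] := eqVneq U set0; first by exists 0.
  exists s => t Ut /=; rewrite in_itv /=; have := hU _ _ Ut Us.
  by rewrite ler_distl.
have [s1 S1] : exists s, S `&` [set t | c <= t] `<=` `[s - L, s + L].
  apply: cover => t u [St /= ct] [Su /= cu]; apply: diamS => //.
  by rewrite ct cu.
have [s2 S2] : exists s, S `&` [set t | ~~ (c <= t)] `<=` `[s - L, s + L].
  apply: cover => t u [St /= ct] [Su /= cu]; apply: diamS => //.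
  by rewrite (negbTE ct) (negbTE cu).
have lI (s : R) : (lebesgueR (`[(s - L)%R, (s + L)%R]%classic : set R) <= (2 * L)%:E)%E.
  rewrite /lebesgueR lebesgue_measure_itv /=; case: ifPn => _.
    by rewrite -EFinD lee_fin; lra.
  by rewrite lee_fin mulr_ge0.
apply: (@le_trans _ _ (lebesgueR (`[(s1 - L)%R, (s1 + L)%R] `|` `[(s2 - L)%R, (s2 + L)%R]))).
  apply: le_measure; rewrite ?inE//; first exact: measurableU.
  move=> t St; have [ct|ct] := boolP (c <= t); first by left; apply: S1.
  by right; apply: S2.
apply: le_trans (measureU2 _ _ _) _ => //.
have -> : 4 * L = 2 * L + 2 * L by lra.
rewrite EFinD; apply: leeD; exact: lI.
Qed.

(** For [d > 0] these cones cover the space; each is cut along its own axis [i], so that lines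
    tangent to the spheres about [q] are avoided. *)
Definition max_coord q i : set (d.-tuple R) :=
  [set x | forall j, `|tnth x j - tnth q j| <= `|tnth x i - tnth q i|].

Lemma measurable_max_coord q i : measurable (max_coord q i).
Proof.
have mt j : measurable_fun [set: d.-tuple R]
    (fun x : d.-tuple R => `|tnth x j - tnth q j|).
  apply: measurableT_comp => //; apply: measurable_funB => //.
  exact: measurable_tnth.
rewrite (_ : max_coord q i = \bigcap_(j in [set: 'I_d])
  [set x : d.-tuple R | `|tnth x j - tnth q j| <= `|tnth x i - tnth q i|]).
  apply: fin_bigcap_measurable => // j _; rewrite -[X in measurable X]setTI.
  exact: (measurable_fun_ler (mt j) (mt i)).
by apply/seteqP; split => [x h j _|x h j]; exact: h.
Qed.

Lemma le_edist_max_coord q i x : max_coord q i x ->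
  edist x q <= d%:R * `|tnth x i - tnth q i|.
Proof.
move=> hx; have d0 : (0 < d)%N by apply: leq_ltn_trans (ltn_ord i).
rewrite -(@ler_pXn2r _ 2)// ?nnegrE ?edist_ge0 ?mulr_ge0//.
rewrite sqr_edist exprMn real_normK ?num_real//.
apply: (@le_trans _ _ (\sum_(j < d) (tnth x i - tnth q i) ^+ 2)).
  apply: ler_sum => j _; rewrite -[leLHS]real_normK ?num_real//.
  by rewrite -[leRHS]real_normK ?num_real// ler_pXn2r ?nnegrE.
(* The bound [d <= d ^ 2] replaces the sharp constant, the square root of [d], by [d]. *)
rewrite sumr_const card_ord -[leLHS]mulr_natl ler_wpM2r ?sqr_ge0//.
by rewrite -[leLHS]mulr1 expr2 ler_wpM2l// ler1n.
Qed.

Lemma sqr_edist_set_tnth q i x t u :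
  edist (set_tnth x i t) q ^+ 2 - edist (set_tnth x i u) q ^+ 2 =
  (t - tnth q i) ^+ 2 - (u - tnth q i) ^+ 2.
Proof.
rewrite !sqr_edist (bigD1 i)//= [in X in _ - X](bigD1 i)//= !tnth_mktuple eqxx.
rewrite (eq_bigr (fun j => (tnth (set_tnth x i u) j - tnth q j) ^+ 2)).
  by rewrite opprD addrACA subrr addr0.
by move=> j /negbTE ji; rewrite !tnth_mktuple ji.
Qed.

(* On the part of a shell where the i-th coordinate of [x - q] dominates, this
   coordinate is at least a multiple of the radius, so that a line parallel to
   the i-th axis crosses the shell in two segments of length [O(eta)],
   uniformly in the radius. *)
Lemma max_coord_shell_section q i r eta x t u : 0 < eta ->
  (shell q r (r + eta) `&` max_coord q i) (set_tnth x i t) ->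
  (shell q r (r + eta) `&` max_coord q i) (set_tnth x i u) ->
  (tnth q i <= t) = (tnth q i <= u) ->
  `|t - u| <= 2 * d%:R * eta.
Proof.
move=> eta0 [/andP[rt tr] mt] [/andP[ru ur] mu] tu.
have d0 : (0 < d)%N by apply: leq_ltn_trans (ltn_ord i).
have d1 : 1 <= d%:R :> R by rewrite ler1n.
have := sqr_edist_set_tnth q i x t u.
have := norm_coord_le_edist (set_tnth x i t) q i.
have := norm_coord_le_edist (set_tnth x i u) q i.
have := le_edist_max_coord _ _ _ mt; have := le_edist_max_coord _ _ _ mu.
have := edist_ge0 (set_tnth x i t) q; have := edist_ge0 (set_tnth x i u) q.
rewrite !tnth_mktuple eqxx.
move: rt tr ru ur; set e1 := edist _ _; set e2 := edist _ _; set c := tnth q i.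
move=> rt tr ru ur e20 e10 ue te uh th E.
pose h1 := `|t - c|; pose h2 := `|u - c|.
(* Both parameters lie on the same side of [c]. *)
have -> : `|t - u| = `|h1 - h2|.
  rewrite /h1 /h2; move: tu; rewrite -/c; case: (leP c t) => ct; case: (leP c u) => cu // _.
    rewrite !(@ger0_norm _ (_ - c)) ?subr_ge0//.
    by have -> : t - c - (u - c) = t - u by lra.
  rewrite !(@ltr0_norm _ (_ - c)) ?subr_lt0// distrC.
  by have -> : - (t - c) - - (u - c) = u - t by lra.
rewrite -/h1 -/h2 in ue te uh th.
have h10 : 0 <= h1 by exact: normr_ge0.
have h20 : 0 <= h2 by exact: normr_ge0.
have {}E : e1 ^+ 2 - e2 ^+ 2 = h1 ^+ 2 - h2 ^+ 2.
  by rewrite E /h1 /h2 !real_normK ?num_real.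
clearbody h1 h2 e1 e2.
(* If [r < eta], both [h1] and [h2] lie between 0 and [r + eta < 2 * eta]. *)
have [re|er] := ltP r eta.
  have : 2 * eta <= 2 * d%:R * eta by nra.
  by rewrite ler_norml; lra.
(* Otherwise [e1 + e2 <= 4 * r], and the difference of squares is the same for [h] as for [e]. The
   cone condition gives [2 * r <= d * (h1 + h2)], which allows division by [r]. *)
have H : `|h1 - h2| * (h1 + h2) <= 4 * r * eta.
  rewrite -[X in _ * X]ger0_norm ?addr_ge0// -normrM -subr_sqr -E subr_sqr.
  rewrite normrM (ger0_norm (addr_ge0 e10 e20)).
  have : `|e1 - e2| <= eta by rewrite ler_norml; lra.
  have := normr_ge0 (e1 - e2); nra.
have r0 : 0 < r by lra.
have := normr_ge0 (h1 - h2); move: H; set D := `|_ - _| => H D0.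
have : D * (2 * r) <= D * (d%:R * (h1 + h2)) by apply: ler_wpM2l => //; lra.
move=> H2; have H3 : D * (d%:R * (h1 + h2)) <= d%:R * (4 * r * eta) by nra.
rewrite -(ler_pM2r (_ : 0 < 2 * r)); last by lra.
by nra.
Qed.

(** Each of the [d] cones meets the shell inside a cube of side [2 * rho], with axis-parallel
    sections of length [O(eta)]. The inner radius [r] may be negative, as happens after rounding. *)
Lemma shell_measure_le (hd : (0 < d)%N) q r eta rho :
  0 < eta -> r + eta <= rho -> 0 <= rho ->
  (lebesgue_Rd R d (shell q r (r + eta)) <=
   (d%:R * ((2 * rho) ^+ d.-1 * (4 * (2 * d%:R * eta))))%:E)%E.
Proof.
move=> eta0 rrho rho0.
pose A i := shell q r (r + eta) `&` max_coord q i.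
have mA i : measurable (A i).
  by apply: measurableI; [exact: measurable_shell|exact: measurable_max_coord].
have -> : shell q r (r + eta) = \bigcup_i A i.
  apply/seteqP; split => [x xs|x [i _ []]//].
  pose i := [arg max_(i > Ordinal hd) `|tnth x i - tnth q i|]%O.
  exists i => //; split=> // j; rewrite /i.
  by case: arg_maxP => // k _; exact.
apply: le_trans (measure_fin_bigcup_le _ mA _) _; last by rewrite card_ord.
move=> i.
have rB (j : 'I_d) : (lebesgueR
    (`[(tnth q j - rho)%R, (tnth q j + rho)%R]%classic : set R) <= (2 * rho)%:E)%E.
  rewrite /lebesgueR lebesgue_measure_itv /=; case: ifPn => _.
    by rewrite -EFinD lee_fin; lra.
  by rewrite lee_fin mulr_ge0.
apply: (power_measure_section_le _
  (fun j => `[(tnth q j - rho)%R, (tnth q j + rho)%R]%classic) _ _ i) => //.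
- by rewrite mulr_ge0.
- by rewrite !mulr_ge0// ltW.
- move=> x [/andP[_ xr] _] j; rewrite /= in_itv /= -ler_distl.
  exact: le_trans (norm_coord_le_edist _ _ _) (le_trans xr rrho).
- move=> x; apply: (@lebesgueR_diam_le (tnth q i)).
  + by rewrite !mulr_ge0// ltW.
  + have : measurable_fun setT (fun t : R => set_tnth x i t).
      apply/measurable_fun_tnthP => j.
      rewrite (_ : _ \o _ = if j == i then id else cst (tnth x j)).
        by case: ifP.
      by apply/funext => t /=; rewrite tnth_mktuple; case: ifP.
    by move=> /(_ measurableT _ (mA i)); rewrite setTI.
  + by move=> t u; exact: max_coord_shell_section.
Qed.

End shells.

(** * Probability that distinct points of the process occupy given sets *)

Section occupation.
Context {R : realType} {d : nat}.
Implicit Types phi : set (d.-tuple R).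

Lemma counting_eq0 (T : choiceType) (X : set T) :
  counting X = 0%E :> \bar R -> X = set0.
Proof.
rewrite /counting; case: asboolP => // finX [] /eqP.
by rewrite pnatr_eq0 finmap.cardfs_eq0 => /eqP /(fset_set_set0 finX).
Qed.

Lemma measurable_hits (B : set (d.-tuple R)) : measurable B ->
  measurable [set phi : configuration R d | (phi : set _) `&` B !=set0].
Proof.
move=> mB; apply: sub_sigma_algebra; exists B, [set~ 0%E]; split => //.
  exact: measurableC.
apply/seteqP; split => phi /=.
  by move=> /set0P /eqP h /counting_eq0.
by move=> h; apply/set0P/eqP => E; apply: h; rewrite E /counting asboolT ?fset_set0.
Qed.

(** For [m > 0] these are the half-open cubes of side [1/m]; they form a countable family that tells
    distinct points apart. *)
Definition mesh_cell (m : nat) (a : d.-tuple int) : set (d.-tuple R) :=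
  [set x | forall l, Num.floor (m%:R * tnth x l) = tnth a l].

Lemma measurable_mesh_cell m a : measurable (mesh_cell m a).
Proof.
apply: (@measurable_tuple_box _ _ _
  (fun l => [set t : R | Num.floor (m%:R * t) = tnth a l])) => l.
rewrite (_ : [set t | _] = (fun t => m%:R * t) @^-1`
    `[(tnth a l)%:~R, (tnth a l + 1)%:~R[); last first.
  apply/seteqP; split => t /=; rewrite in_itv /=.
    by move=> <-; exact: floor_itv.
  exact: floor_def.
rewrite -[X in measurable X]setTI; exact: measurable_funM.
Qed.

Lemma mesh_cell_separates n (x : n.-tuple (d.-tuple R)) : uniq x ->
  exists (m : nat) (a : n.-tuple (d.-tuple int)),
    uniq a /\ forall i, mesh_cell m (tnth a i) (tnth x i).
Proof.
move=> ux.
(* As the inverse of 0 is 0, equal coordinates contribute nothing, and [s] bounds the inverse of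
   every nonzero coordinate distance. Hence [1/m] is below all of these distances. *)
pose D i j l := `|(tnth (tnth x i) l - tnth (tnth x j) l)^-1|.
pose s := \sum_(i < n) \sum_(j < n) \sum_(l < d) D i j l.
have Ds i j l : D i j l <= s.
  rewrite /s (bigD1 i)//= (bigD1 j)//= (bigD1 l)//= -!addrA lerDl.
  by rewrite !addr_ge0//; do !apply: sumr_ge0 => ? _; exact: normr_ge0.
pose m := (Num.truncn s).+1.
have sm : s < m%:R by exact: truncnS_gt.
pose f (y : d.-tuple R) := [tuple Num.floor (m%:R * tnth y l) | l < d].
exists m, [tuple f (tnth x i) | i < n]; split; last first.
  by move=> i l; rewrite !tnth_mktuple.
rewrite map_inj_uniq ?enum_uniq// => i j /eqP; apply: contraTeq => ij.
have : tnth x i != tnth x j.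
  by apply: contra_neq ij; exact: (tuple_uniqP _ ux).
apply: contraNneq => fij; apply/eqP/eq_from_tnth => l; apply/eqP.
apply/negPn/negP => xl.
have /(congr1 (fun t => tnth t l)) := fij; rewrite !tnth_mktuple.
set u := tnth (tnth x i) l in xl *; set v := tnth (tnth x j) l in xl * => fl.
have := floor_itv (m%:R * u); have := floor_itv (m%:R * v).
rewrite fl !intrD /= => /andP[a1 a2] /andP[b1 b2].
have uv : 0 < `|u - v| by rewrite normr_gt0 subr_eq0.
have : 1 < m%:R * `|u - v|.
  have := le_lt_trans (Ds i j l) sm; rewrite /D -/u -/v normfV => h.
  by rewrite mulrC -ltr_pdivrMl// mulr1.
apply/negP; rewrite -leNgt -[m%:R]ger0_norm// -normrM mulrBr ler_norml.
by move: a1 a2 b1 b2; set k := (Num.floor _)%:~R; lra.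
Qed.

Context {dO : measure_display} {Omega : measurableType dO} {P : probability Omega R}.
Context (Psi : {RV P >-> configuration R d}).

Definition occupied {n} (B : 'I_n -> set (d.-tuple R)) : set Omega :=
  [set w | exists x : n.-tuple (d.-tuple R),
     distinct_tuples (Psi w) x /\ forall i, B i (tnth x i)].

(* The integral of a non-measurable nonnegative function is a lower integral,
   so that Markov's inequality for the counting functional rests on this. *)
Lemma measurable_occupied {n} (B : 'I_n -> set (d.-tuple R)) :
  (forall i, measurable (B i)) -> measurable (occupied B).
Proof.
move=> mB.
(* Distinct points lie in distinct cells of a fine enough mesh, and points in distinct cells are
   distinct. This reduces the event to countably many hitting events for single cells. *)
have -> : occupied B = \bigcup_(m : nat) \bigcup_(a : n.-tuple (d.-tuple int))
    (if uniq a then \bigcap_(i in [set: 'I_n])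
       [set w | (Psi w : set _) `&` (B i `&` mesh_cell m (tnth a i)) !=set0]
     else set0).
  apply/seteqP; split => w.
    move=> [x [[ux Px] Bx]]; have [m [a [ua xa]]] := mesh_cell_separates _ _ ux.
    exists m => //; exists a => //; rewrite ua => i _.
    by exists (tnth x i); split; [exact: Px|split].
  move=> [m _ [a _]]; case: ifPn => // ua h.
  have /choice[f fP] : forall i : 'I_n, exists y,
      ((Psi w : set _) `&` (B i `&` mesh_cell m (tnth a i))) y by move=> i; exact: h.
  exists [tuple f i | i < n]; split; last by move=> i; rewrite tnth_mktuple; have [_ []] := fP i.
  split; last by move=> i; rewrite tnth_mktuple; have [] := fP i.
  rewrite map_inj_uniq ?enum_uniq// => i j fij.
  apply: (tuple_uniqP _ ua); apply: eq_from_tnth => l.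
  have [_ [_ /(_ l) <-]] := fP i; have [_ [_ /(_ l) <-]] := fP j.
  by rewrite fij.
apply: bigcupT_measurable => m.
apply: countable_bigcupT_measurable => // a; case: ifPn => // _.
apply: fin_bigcap_measurable => // i _.
apply: (measurable_funPTI Psi (measurable_hits _ _)).
by apply: measurableI => //; exact: measurable_mesh_cell.
Qed.

Lemma occupied_le {n} (rho : n.-tuple (d.-tuple R) -> \bar R)
    (B : 'I_n -> set (d.-tuple R)) (K b : R) :
  correlation_function Psi rho -> (forall x, rho x <= K%:E)%E -> 0 <= K ->
  (forall i, measurable (B i)) -> (forall i, lebesgue_Rd R d (B i) <= b%:E)%E ->
  (P (occupied B) <= (K * b ^+ n)%:E)%E.
Proof.
move=> [mrho rho0 rhoP] rhoK K0 mB Bb.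
pose X := [set x : n.-tuple (d.-tuple R) | forall i, B i (tnth x i)].
have mX : measurable X by exact: measurable_tuple_box.
apply: (@le_trans _ _ (\int[P]_w counting (distinct_tuples (Psi w) `&` X))%E).
  rewrite -[occupied B]setIT -integral_indic//; last exact: measurable_occupied.
  have c0 (w : Omega) : (0 <= counting (distinct_tuples (Psi w) `&` X) :> \bar R)%E.
    by rewrite /counting; case: ifPn => _; rewrite ?leey// lee_fin.
  (* Markov's inequality without measurability of the count: every simple function below the
     indicator is below the count, so the suprema compare. *)
  rewrite !ge0_integralTE//.
  apply: le_ereal_sup => _ [h hE <-]; exists h => // w.
  apply: le_trans (hE w) _; rewrite indicE.
  have [/set_mem[x [Px Bx]]|_] := boolP (w \in occupied B); last exact: c0.
  rewrite /counting; case: ifPn => [/asboolP fin|_]; last exact: leey.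
  rewrite lee_fin ler_nat finmap.cardfs_gt0.
  by apply/finmap.fset0Pn; exists x; rewrite in_fset_set// inE.
rewrite rhoP// EFinM; apply: (@le_trans _ _ (K%:E * lebesgue_Rdn R d n X)%E).
  rewrite -integral_cst//; apply: ge0_le_integral => //.
    exact: measurable_funTS.
by rewrite lee_wpmul2l ?lee_fin// power_measure_box_le.
Qed.

End occupation.

(** * Finiteness, Euclidean distance and lattice differences *)

Lemma bounded_of_injective_fin {T : finType} (P : nat -> Prop) (f : nat -> T) :
  (forall i j, P i -> P j -> f i = f j -> i = j) ->
  exists N, forall i, P i -> (i < N)%N.
Proof.
move=> injf.
have /choice[b bP] : forall t, exists b, forall i, P i -> f i = t -> (i < b)%N.
  move=> t; have [[i [Pi fi]]|no] := pselect (exists i, P i /\ f i = t).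
    by exists i.+1 => j Pj fj; rewrite (injf j i) ?fi.
  by exists 0%N => i Pi fi; case: no; exists i.
exists (\max_t b t) => i Pi.
by apply: leq_trans (bP (f i) i Pi erefl) _; exact: (leq_bigmax (f i)).
Qed.

Section euclidean.
Context {R : realType} {d : nat}.
Implicit Types x y p q : d.-tuple R.

Lemma edist_sym x y : edist x y = edist y x.
Proof.
by congr Num.sqrt; apply: eq_bigr => i _; rewrite -sqrrN opprB.
Qed.

(** The Cauchy-Schwarz inequality, from which the triangle inequality for [edist] follows. *)
Lemma sum_mul_le_sqrt (a b : 'I_d -> R) :
  \sum_i a i * b i <=
  Num.sqrt (\sum_i a i ^+ 2) * Num.sqrt (\sum_i b i ^+ 2).
Proof.
set A := Num.sqrt _; set B := Num.sqrt _.
have A0 : 0 <= A by exact: sqrtr_ge0.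
have B0 : 0 <= B by exact: sqrtr_ge0.
have A2 : A ^+ 2 = \sum_i a i ^+ 2.
  by rewrite sqr_sqrtr// sumr_ge0// => i _; exact: sqr_ge0.
have B2 : B ^+ 2 = \sum_i b i ^+ 2.
  by rewrite sqr_sqrtr// sumr_ge0// => i _; exact: sqr_ge0.
have zero (e : 'I_d -> R) : \sum_i e i ^+ 2 = 0 -> forall i, e i = 0.
  move=> /eqP; rewrite psumr_eq0 => [/allP h i|i _]; last exact: sqr_ge0.
  by have := h i (mem_index_enum i); rewrite sqrf_eq0 => /eqP.
have [A00|An] := eqVneq A 0.
  rewrite big1 ?mulr_ge0// => i _.
  by rewrite (zero a) ?mul0r// -A2 A00 expr0n.
have [B00|Bn] := eqVneq B 0.
  rewrite big1 ?mulr_ge0// => i _.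
  by rewrite (zero b) ?mulr0// -B2 B00 expr0n.
have AB : 0 < 2 * (A * B).
  by rewrite !mulr_gt0// lt0r ?An ?Bn.
(* the sum of the squares of [B a_i - A b_i] is nonnegative *)
rewrite -(ler_pM2l AB) -subr_ge0.
have : 0 <= \sum_i (B * a i - A * b i) ^+ 2.
  by apply: sumr_ge0 => i _; exact: sqr_ge0.
congr (0 <= _).
transitivity (B ^+ 2 * (\sum_i a i ^+ 2) - 2 * (A * B) * (\sum_i a i * b i) +
    A ^+ 2 * (\sum_i b i ^+ 2)).
  rewrite !mulr_sumr -sumrB -big_split /=; apply: eq_bigr => i _; ring.
by rewrite -A2 -B2; ring.
Qed.

Lemma edist_triangle x y q : edist x y <= edist x q + edist q y.
Proof.
rewrite -(@ler_pXn2r _ 2)// ?nnegrE ?addr_ge0 ?edist_ge0//.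
rewrite sqrrD !sqr_edist.
have := sum_mul_le_sqrt (fun i => tnth x i - tnth q i)
  (fun i => tnth q i - tnth y i); rewrite -/(edist x q) -/(edist q y) => h.
have -> : \sum_(i < d) (tnth x i - tnth y i) ^+ 2 =
    \sum_(i < d) (tnth x i - tnth q i) ^+ 2 +
    (\sum_(i < d) (tnth x i - tnth q i) * (tnth q i - tnth y i)) *+ 2 +
    \sum_(i < d) (tnth q i - tnth y i) ^+ 2.
  by rewrite -sumrMnl -!big_split /=; apply: eq_bigr => i _; ring.
by rewrite lerD2r lerD2l lerMn2r.
Qed.

Definition lattice_point (k : d.-tuple int) (u : d.-tuple R) : d.-tuple R :=
  addt [tuple (tnth k i)%:~R | i < d] u.

(** Integer vectors with entries in [[-N, N]], encoded in a finite type so that they can be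
    counted. *)
Definition offset {N : nat} (e : {ffun 'I_d -> 'I_(N.*2.+1)}) (i : 'I_d) : int :=
  (e i)%:Z - N%:Z.

(** Both lattice points are within [r] of [x], so their coordinates differ by at most [2 * r]; the
    common shift [u] cancels. *)
Lemma offset_lattice_point (k l : d.-tuple int) (u x : d.-tuple R) (N : nat) (r : R) :
  edist x (lattice_point k u) <= r -> edist x (lattice_point l u) <= r ->
  2 * r <= N%:R ->
  exists e : {ffun 'I_d -> 'I_(N.*2.+1)}, forall i, tnth l i = tnth k i + offset e i.
Proof.
move=> kr lr rN.
have klN i : `|tnth l i - tnth k i| <= N%:Z.
  rewrite -(ler_int R) intr_norm intrB; apply: le_trans rN.
  have := le_trans (norm_coord_le_edist _ _ i) kr.
  have := le_trans (norm_coord_le_edist _ _ i) lr.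
  by rewrite !tnth_mktuple !ler_norml; lra.
exists [ffun i => inord (absz (tnth l i - tnth k i + N%:Z))] => i.
rewrite /offset ffunE; have := klN i; rewrite ler_norml => /andP[lo hi].
have h0 : 0 <= tnth l i - tnth k i + N%:Z by lia.
rewrite inordK; first by rewrite gez0_abs//; lia.
by lia.
Qed.

End euclidean.

(** * Combinatorics of descending chains *)

Section chains.
Context {R : realType} {d : nat}.
Context (u : d.-tuple R) (psi : set (d.-tuple R)) (z : nat -> d.-tuple R)
  (zP : infinite_descending_chain (shifted_lattice u) psi z).

Let r i := edist (z i.+1) (z i).

(** The second clause records ties at points of [psi]: there the chain moves to a lexicographically
    greater lattice point. *)
Lemma chain_step i : (1 <= i)%N ->
  r i.+1 <= r i /\
  (r i.+1 = r i -> ~~ odd i.+1 -> lex_lt (z i) (z i.+2)).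
Proof.
move=> i1; have := zP.2 i.+1 i1; rewrite /r (edist_sym (z i.+1) (z i)) /=.
case: ifPn => /= odd_i.
  by case=> [/ltW//|[-> _]]; split.
case=> [lt_r|[-> lex]]; last by split.
by split; [exact: ltW|move=> E; rewrite E ltxx in lt_r].
Qed.

Lemma chain_dist_le i j : (1 <= i)%N -> (i <= j)%N -> r j <= r i.
Proof.
move=> i1 /subnKC <-; elim: (j - i)%N => [|m IH]; first by rewrite addn0.
rewrite addnS; apply: le_trans IH.
by have [] := chain_step _ (leq_trans i1 (leq_addr m i)).
Qed.

(* Returning to the same vertex and leaving along the same edge would force
   all distances in between to agree, and then the ties are broken
   monotonically. *)
Lemma chain_edge_neq i j : (2 <= i)%N -> ~~ odd i -> ~~ odd j -> (i < j)%N ->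
  z i = z j -> z i.+1 <> z j.+1.
Proof.
move=> i2 evi evj ij zij zij1.
have rij : r i = r j by rewrite /r zij zij1.
have i1 : (1 <= i)%N by exact: ltnW.
have cst l : (i <= l <= j)%N -> r l = r i.
  move=> /andP[il lj]; apply/eqP; rewrite eq_le chain_dist_le//= rij.
  exact: chain_dist_le (leq_trans i1 il) lj.
have [m mE] : exists m, j = (i + m.+1.*2)%N.
  exists (j - i)./2.-1.
  have := odd_double_half (j - i); rewrite oddB ?(ltnW ij)// (negbTE evi) (negbTE evj).
  lia.
suff : lex_lt (z i.+1) (z j.+1) by rewrite zij1 /lex_lt ltxx.
(* All these edges have the same length, so the successive lattice points increase strictly. *)
have H l : (l < m.+1)%N -> lex_lt (z (i + l.*2).+1) (z (i + l.*2).+3).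
  move=> lm; have [_] := chain_step (i + l.*2).+1 isT; apply.
    by rewrite !cst//; apply/andP; split; lia.
  by rewrite /= oddD odd_double addbF negbK.
rewrite mE => {mE cst ij}; elim: m H => [|m IH] H.
  by have := H 0%N isT; rewrite double0 addn0 doubleS double0 !addnS addn0.
have := H m.+1 (leqnn _); have := IH (fun l lm => H l (ltnW lm)).
rewrite /lex_lt => h1 h2; apply: lt_trans h1 _.
by have -> : (i + m.+2.*2).+1 = (i + m.+1.*2).+3 by lia.
Qed.

Lemma chain_lattice i : odd i -> exists k, z i = lattice_point k u.
Proof.
move=> oi; have := zP.1 i; rewrite oi => /(_ (odd_gt0 oi)) [k _ <-].
by exists k.
Qed.

(** Every visit to [z i] is followed by a lattice point within [r i] of it, and different visits
    have different successors. Only finitely many lattice points are that close. *)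
Lemma chain_last_visit i : (2 <= i)%N -> ~~ odd i ->
  exists j, [/\ (i <= j)%N, ~~ odd j, z j = z i &
    forall l, (j < l)%N -> ~~ odd l -> z l <> z i].
Proof.
move=> i2 evi.
have /choice[k kP] : forall j, exists k, odd j -> z j = lattice_point k u.
  move=> j; have [oj|] := boolP (odd j); last by exists [tuple 0 | _ < d].
  by have [k kE] := chain_lattice _ oj; exists k.
pose V l := [/\ (i <= l)%N, ~~ odd l & z l = z i].
have Vr l : V l -> edist (z i) (lattice_point (k l.+1) u) <= r i.
  move=> [il evl zl]; rewrite -kP//= -zl edist_sym.
  by apply: chain_dist_le il; exact: ltnW.
have Vi : V i by split.
pose N := (Num.truncn (2 * r i)).+1.
have /choice[e eP] : forall l, exists e : {ffun 'I_d -> 'I_(N.*2.+1)}, V l ->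
    forall c, tnth (k l.+1) c = tnth (k i.+1) c + offset e c.
  move=> l; have [Vl|nV] := pselect (V l); last by exists [ffun=> ord0].
  have [e eP] := offset_lattice_point _ _ _ _ N _ (Vr i Vi) (Vr l Vl) (ltW (truncnS_gt _)).
  by exists e.
have [b bP] : exists b, forall l, V l -> (l < b)%N.
  apply: (bounded_of_injective_fin V e) => l m Vl Vm elm.
  have zlm : z l.+1 = z m.+1.
    have [[_ ol _] [_ om _]] := (Vl, Vm).
    rewrite !kP//=; congr lattice_point; apply: eq_from_tnth => c.
    by rewrite (eP l Vl) (eP m Vm) elm.
  wlog lm : l m Vl Vm {elm} zlm / (l < m)%N.
    move=> h; case: (ltngtP l m) => // [|ml]; first exact: h.
    by apply/esym/h.
  have [[il ol zl] [im om zm]] := (Vl, Vm).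
  by case: (chain_edge_neq l m (leq_trans i2 il) ol om lm _ zlm); rewrite zl zm.
have exV : exists l, `[< V l >] by exists i; apply/asboolP.
have ubV l : `[< V l >] -> (l <= b)%N by move=> /asboolP/bP/ltnW.
case: (ex_maxnP exV ubV) => j /asboolP[ij evj zj] jmax.
exists j; split => // l jl evl zl.
have /jmax : `[< V l >] by apply/asboolP; split=> //; exact: leq_trans ij (ltnW jl).
by rewrite leqNgt jl.
Qed.

(* Loop erasure at the points of [psi]. *)
Lemma chain_self_avoiding : exists (x : nat -> d.-tuple R) (k : nat -> d.-tuple int),
  [/\ z 1%N = lattice_point (k 0%N) u, injective x, (forall l, psi (x l)),
     edist (x 0%N) (lattice_point (k 0%N) u) = edist (z 2%N) (z 1%N) &
   (forall l, edist (x l.+1) (lattice_point (k l.+1) u) <=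
              edist (x l) (lattice_point (k l) u)) /\
   (forall l, edist (x l) (lattice_point (k l.+1) u) <=
              edist (x 0%N) (lattice_point (k 0%N) u))].
Proof.
have /choice[lv lvP] : forall i, exists j, (2 <= i)%N -> ~~ odd i ->
    [/\ (i <= j)%N, ~~ odd j, z j = z i &
    forall l, (j < l)%N -> ~~ odd l -> z l <> z i].
  move=> i; have [[i2 oi]|no] := pselect ((2 <= i)%N /\ ~~ odd i).
    by have [j jP] := chain_last_visit i i2 oi; exists j.
  by exists 0%N => i2 oi; case: no.
(* From a last visit the walk goes two steps on, to the next point of [psi], and jumps to the last
   visit there. *)
pose idx := fix idx l := if l is m.+1 then lv (idx m).+2 else lv 2%N.
have idxP l : (2 <= idx l)%N /\ ~~ odd (idx l).
  elim: l => [|l [IH2 IHo]] /=; first by have [] := lvP 2%N isT isT.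
  have [] := lvP (idx l).+2; rewrite ?negbK//.
  by move=> h o _ _; split=> //; exact: leq_trans h.
have idxS l : ((idx l).+2 <= idx l.+1)%N /\ z (idx l.+1) = z (idx l).+2.
  have [l2 lo] := idxP l; have [] := lvP (idx l).+2; rewrite /= ?negbK//.
have z0 : z (idx 0%N) = z 2%N by have [] := lvP 2%N isT isT.
have idx_last l m : (idx l < m)%N -> ~~ odd m -> z m <> z (idx l).
  case: l => [|l]; first by rewrite z0; have [_ _ _] := lvP 2%N isT isT; exact.
  rewrite (idxS l).2; have [l2 lo] := idxP l.
  by have [] := lvP (idx l).+2; rewrite /= ?negbK// => _ _ _; exact.
have idx_lt l m : (l < m)%N -> (idx l < idx m)%N.
  elim: m => // m IH; rewrite ltnS leq_eqVlt => /predU1P[->|/IH h].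
    exact: ltnW (idxS m).1.
  exact: ltn_trans h (ltnW (idxS m).1).
have /choice[k kP] : forall j, exists k, odd j -> z j = lattice_point k u.
  move=> j; have [oj|] := boolP (odd j); last by exists [tuple 0 | _ < d].
  by have [k kE] := chain_lattice _ oj; exists k.
(* The lattice point paired with [x l] is the one from which the walk enters it: a jump does not
   change the point, so [x l] is also [z (q l).+1]. *)
pose q l := if l is m.+1 then (idx m).+1 else 1%N.
have qP l : odd (q l) by case: l => //= l; have [] := idxP l.
have xq l : z (idx l) = z (q l).+1.
  by case: l => [|l] //; exact: (idxS l).2.
have r1 i : (1 <= i)%N -> r i <= r 1%N by exact: chain_dist_le.
exists (fun l => z (idx l)), (fun l => k (q l)).
split=> [||l||].
- by rewrite -kP.
- move=> l m /= zlm; case: (ltngtP l m) => // /idx_lt h.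
  + by case: (idx_last _ _ h (idxP _).2).
  + by case: (idx_last _ _ h (idxP _).2).
- by have [l2 lo] := idxP l; have := zP.1 _ (ltnW l2); rewrite (negbTE lo).
- by rewrite -kP// xq.
- split=> l; rewrite -!kP ?qP//.
    rewrite xq (xq l); apply: chain_dist_le; first by case: l.
    case: l => [|l] //; rewrite /q ltnS; apply: leq_trans (idxS l).1.
    exact: leqW.
  by rewrite edist_sym (xq 0%N); apply: r1; exact: ltnW (idxP l).1.
Qed.

End chains.

(** * Elementary growth estimates *)

Lemma bin_le_exp2 m k : ('C(m, k) <= 2 ^ m)%N.
Proof.
elim: m k => [[]//|m IH [|k]]; first by rewrite bin0 expn_gt0.
by rewrite binS expnS mul2n -addnn leq_add.
Qed.

Lemma powR_sublinear {R : realType} (theta H tau : R) :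
  theta < 1 -> 0 < H -> 0 < tau ->
  exists n : nat, (0 < n)%N /\ H * (n%:R `^ theta / n%:R) <= tau.
Proof.
move=> t1 H0 tau0; set a := 1 - theta.
have a0 : 0 < a by rewrite subr_gt0.
(* The number [s] solves [s ^ (1 - theta) = H / tau], and any larger [n] works. *)
pose s := (H / tau) `^ a^-1.
exists (Num.truncn s).+1; split=> //; set n := (_.+1)%:R.
have n0 : 0 < n by rewrite ltr0n.
have sn : s <= n by exact/ltW/truncnS_gt.
have : H / tau <= n `^ a.
  have -> : H / tau = s `^ a.
    by rewrite /s -powRrM mulVf ?gt_eqF// powRr1// divr_ge0// ltW.
  by apply: ge0_ler_powR; rewrite ?nnegrE ?powR_ge0// ltW.
rewrite ler_pdivrMr// => h.
have nE : n = n `^ theta * n `^ a.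
  rewrite -powRD; first by rewrite /a addrC subrK powRr1// ltW.
  by apply/implyP => _; rewrite gt_eqF.
rewrite mulrA ler_pdivrMr//; apply: le_trans (ler_wpM2r (powR_ge0 n theta) h) _.
have -> : n `^ a * tau * n `^ theta = tau * (n `^ theta * n `^ a) by ring.
by rewrite -nE.
Qed.

(** * Finite encoding of the initial segment of a self-avoiding chain *)

Section discretization.
Context {R : realType} {d : nat}.
Implicit Types (u q : d.-tuple R) (k : d.-tuple int).

(** Approximates the lattice point of index [l]: start [k0], plus the first [l] lattice differences
    with entries in [[-2M, 2M]], plus the shift rounded down to mesh [1/(n d)]. *)
Definition mesh_center {n M : nat} (k0 : d.-tuple int)
    (c : {ffun 'I_d -> 'I_(n * d)})
    (e : {ffun 'I_n -> {ffun 'I_d -> 'I_(M.*2.*2.+1)}}) (l : nat) : d.-tuple R :=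
  [tuple (tnth k0 i + \sum_(m < n | (m < l)%N) offset (N := M.*2) (e m) i)%:~R
     + (c i)%:R / (n * d)%:R | i < d].

(** Distances are counted downwards from [n * M], so that nonincreasing distances give sorted
    sequences [j]; the final [- 1] absorbs the displacement of the centre. *)
Definition mesh_radius (n M j : nat) : R := ((n * M)%:R - j%:R - 1) / n%:R.

(** Of the thickness [3 / n], one unit is for rounding the distance and one on either side for
    rounding the centre. *)
Definition mesh_shell {n M : nat} (k0 : d.-tuple int)
    (p : {ffun 'I_d -> 'I_(n * d)} *
         {ffun 'I_n -> {ffun 'I_d -> 'I_(M.*2.*2.+1)}} *
         {t : n.-tuple 'I_(n * M).+1 | sorted leq (map val t)})
    (l : 'I_n) : set (d.-tuple R) :=
  shell (mesh_center k0 p.1.1 p.1.2 l)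
    (mesh_radius n M (tnth (val p.2) l))
    (mesh_radius n M (tnth (val p.2) l) + 3 / n%:R).

(** Each coordinate is off by at most [1/(n d)], and [d] such squares sum to at most [1/n^2]. *)
Lemma edist_lattice_mesh k u (c : 'I_d -> nat) n : (0 < n)%N ->
  (forall i, (c i)%:R <= (n * d)%:R * tnth u i < (c i).+1%:R) ->
  edist (lattice_point k u)
    [tuple (tnth k i)%:~R + (c i)%:R / (n * d)%:R | i < d] <= n%:R^-1.
Proof.
move=> n0 cP; rewrite -(@ler_pXn2r _ 2)// ?nnegrE ?edist_ge0 ?invr_ge0//.
rewrite sqr_edist.
have nR : 0 < n%:R :> R by rewrite ltr0n.
apply: (@le_trans _ _ (\sum_(i < d) ((n * d)%:R^-1) ^+ 2)).
  apply: ler_sum => i _; rewrite !tnth_mktuple.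
  have d0 : (0 < n * d)%N by rewrite muln_gt0 n0 (leq_ltn_trans _ (ltn_ord i)).
  have nd : 0 < (n * d)%:R :> R by rewrite ltr0n.
  have -> : (tnth k i)%:~R + tnth u i - ((tnth k i)%:~R + (c i)%:R / (n * d)%:R)
      = ((n * d)%:R * tnth u i - (c i)%:R) / (n * d)%:R :> R.
    by rewrite mulrBl (mulrC (n * d)%:R) mulfK ?gt_eqF//; ring.
  have := cP i; rewrite -addn1 natrD => /andP[h1 h2].
  rewrite ler_pXn2r ?nnegrE ?invr_ge0 ?divr_ge0 ?subr_ge0//.
  by rewrite -[leRHS]mul1r ler_pM2r ?invr_gt0//; lra.
rewrite sumr_const card_ord -[leLHS]mulr_natl natrM invfM exprMn mulrCA -[leRHS]mulr1.
rewrite ler_wpM2l ?sqr_ge0//; case: (posnP d) => [->|d0]; first by rewrite mul0r.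
have dR : 0 < d%:R :> R by rewrite ltr0n.
by rewrite expr2 mulrA divff ?gt_eqF// mul1r invf_le1// ler1n.
Qed.

Lemma chain_in_mesh_shells (hd : (0 < d)%N) u (n M : nat)
    (x : nat -> d.-tuple R) (k : nat -> d.-tuple int) :
  (0 < n)%N -> (forall i, 0 <= tnth u i < 1) ->
  edist (x 0%N) (lattice_point (k 0%N) u) <= M%:R ->
  (forall l, edist (x l.+1) (lattice_point (k l.+1) u) <=
             edist (x l) (lattice_point (k l) u)) ->
  (forall l, edist (x l) (lattice_point (k l.+1) u) <=
             edist (x 0%N) (lattice_point (k 0%N) u)) ->
  exists p, forall l : 'I_n, @mesh_shell n M (k 0%N) p l (x l).
Proof.
move=> n0 u01 rM rdec rx; pose rho l := edist (x l) (lattice_point (k l) u).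
have nR : 0 < n%:R :> R by rewrite ltr0n.
have ndR : 0 < (n * d)%:R :> R by rewrite ltr0n muln_gt0 n0.
have rho0 l : 0 <= rho l by exact: edist_ge0.
have rho_le l : rho l <= rho 0%N.
  by elim: l => // l IH; apply: le_trans (rdec l) IH.
pose c0 i := Num.truncn ((n * d)%:R * tnth u i).
have c0P i : (c0 i)%:R <= (n * d)%:R * tnth u i < (c0 i).+1%:R.
  by apply: truncn_itv; have /andP[ui _] := u01 i; rewrite mulr_ge0// ltW.
have c0lt i : (c0 i < n * d)%N.
  rewrite -(ltr_nat R); have /andP[h _] := c0P i; apply: le_lt_trans h _.
  by have /andP[_ ui] := u01 i; rewrite -[ltRHS]mulr1 ltr_pM2l.
pose c : {ffun 'I_d -> 'I_(n * d)} := [ffun i => Ordinal (c0lt i)].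
(* Consecutive lattice points are both within [M] of [x m], whence the bound [2M] on their
   difference. *)
have /choice[e0 e0P] : forall m, exists e : {ffun 'I_d -> 'I_(M.*2.*2.+1)},
    forall i, tnth (k m.+1) i = tnth (k m) i + offset (N := M.*2) e i.
  move=> m; apply: (offset_lattice_point _ _ u (x m) _ M%:R).
  - exact: le_trans (rho_le m) rM.
  - exact: le_trans (rx m) rM.
  - by rewrite -mul2n natrM.
pose e : {ffun 'I_n -> {ffun 'I_d -> 'I_(M.*2.*2.+1)}} := [ffun m : 'I_n => e0 m].
have kE l i : (l <= n)%N -> tnth (k l) i =
    tnth (k 0%N) i + \sum_(m < n | (m < l)%N) offset (N := M.*2) (e m) i.
  elim: l => [|l IH] ln; first by rewrite big_pred0 ?addr0.
  rewrite e0P IH ?(ltnW ln)// -addrA; congr (_ + _).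
  rewrite [in RHS](bigD1 (Ordinal ln))//= addrC ffunE; congr (_ + _).
  by apply: eq_bigl => m; rewrite ltnS (leq_eqVlt m) -val_eqE /=; case: ltngtP.
pose j0 l := (n * M - Num.truncn (n%:R * rho l))%N.
have j0lt l : (j0 l < (n * M).+1)%N by rewrite ltnS leq_subr.
pose t : n.-tuple 'I_(n * M).+1 := [tuple Ordinal (j0lt l) | l < n].
have t_sorted : sorted leq (map val t).
  apply/(sortedP 0%N) => l; rewrite size_map size_tuple => ln.
  have E m (mn : (m < n)%N) : nth 0%N (map val t) m = j0 m.
    rewrite (nth_map ord0) ?size_tuple// -[m]/(val (Ordinal mn)).
    by rewrite -(tnth_nth ord0) tnth_mktuple.
  rewrite !E ?(ltnW ln)//; apply: leq_sub2l; apply: le_truncn.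
  by rewrite ler_pM2l//; exact: rdec.
exists (c, e, Sub t t_sorted) => l; rewrite /mesh_shell /= /shell /=.
rewrite tnth_mktuple /=.
set q := mesh_center _ _ _ _.
have qd : edist (lattice_point (k l) u) q <= n%:R^-1.
  have -> : q = [tuple (tnth (k l) i)%:~R + (c0 i)%:R / (n * d)%:R | i < d].
    apply: eq_from_tnth => i; rewrite !tnth_mktuple (kE l) ?(ltnW (ltn_ord l))//.
    by have -> : c i = Ordinal (c0lt i) by rewrite ffunE.
  exact: edist_lattice_mesh.
set T := Num.truncn (n%:R * rho l).
have /andP[T1 T2] : T%:R <= n%:R * rho l < T.+1%:R.
  by apply: truncn_itv; rewrite mulr_ge0.
(* This makes the natural-number subtraction in [j0] exact. *)
have TM : (T <= n * M)%N.
  rewrite -(ler_nat R); apply: le_trans T1 _; rewrite natrM ler_pM2l//.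
  exact: le_trans (rho_le l) rM.
have -> : mesh_radius n M (j0 l) = (T%:R - 1) / n%:R.
  by rewrite /mesh_radius /j0 -/T natrB//; congr (_ / _); ring.
(* Moving the centre changes the distance by at most [1/n], so [n] times it lies between [T - 1] and
   [T + 2]. *)
have tr1 := edist_triangle (x l) q (lattice_point (k l) u).
have tr2 := edist_triangle (x l) (lattice_point (k l) u) q.
rewrite (edist_sym q) in tr2; rewrite -/(rho l) in tr1 tr2.
have h1 : n%:R * edist (x l) q <= n%:R * rho l + 1.
  rewrite -[X in _ <= _ + X](divff (lt0r_neq0 nR)) -mulrDr ler_pM2l//; lra.
have h2 : n%:R * rho l <= n%:R * edist (x l) q + 1.
  rewrite -[X in _ <= _ + X](divff (lt0r_neq0 nR)) -mulrDr ler_pM2l//; lra.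
rewrite -mulrDl ler_pdivrMr// ler_pdivlMr// ![_ * n%:R]mulrC.
by move: T2; rewrite -addn1 natrD; lra.
Qed.

Lemma measurable_mesh_shell n M k0 p l : measurable (@mesh_shell n M k0 p l).
Proof. exact: measurable_shell. Qed.

Lemma mesh_shell_measure_le (hd : (0 < d)%N) (M : nat) : exists A : R, 0 < A /\
  forall n, (0 < n)%N -> forall k0 p (l : 'I_n),
    (lebesgue_Rd R d (@mesh_shell n M k0 p l) <= (A / n%:R)%:E)%E.
Proof.
have dR : 0 < d%:R :> R by rewrite ltr0n.
have M2 : 0 < M%:R + 2 :> R by rewrite ltr_wpDl.
(* The outer radius is at most [M + 2 / n <= M + 2], so the constant is independent of [n]. *)
exists (d%:R * ((2 * (M%:R + 2)) ^+ d.-1 * (4 * (2 * d%:R * 3)))); split.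
  by rewrite !(mulr_gt0, exprn_gt0).
move=> n n0 k0 p l; have nR : 0 < n%:R :> R by rewrite ltr0n.
apply: le_trans (shell_measure_le hd _ _ _ (M%:R + 2) _ _ (ltW M2)) _.
- by rewrite divr_gt0.
- rewrite /mesh_radius -mulrDl ler_pdivrMr// natrM mulrDl mulrC.
  have : 1 <= n%:R :> R by rewrite ler1n.
  have : 0 <= (tnth (val p.2) l)%:R :> R by exact: ler0n.
  lra.
- by rewrite lee_fin !mulrA.
Qed.

End discretization.

(** * The first moment estimate and its limit *)

Section first_moment.
Context {R : realType} {d : nat}.
Context {dO : measure_display} {Omega : measurableType dO} {P : probability Omega R}.
Context (Psi : {RV P >-> configuration R d}) (U : {RV P >-> d.-tuple R}).

Definition chain_event (k0 : d.-tuple int) (M : nat) : set Omega :=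
  [set w | exists z : nat -> d.-tuple R,
     [/\ infinite_descending_chain (shifted_lattice (U w)) (Psi w) z,
         z 1%N = lattice_point k0 (U w) &
         edist (z 2%N) (z 1%N) <= M%:R]].

Lemma lattice_point_inj (u : d.-tuple R) : injective (lattice_point ^~ u).
Proof.
move=> k l /= kl; apply: eq_from_tnth => i.
have := congr1 (fun t => tnth t i) kl; rewrite !tnth_mktuple => /addIr.
exact: intr_inj.
Qed.

Lemma chain_event_sub_occupied (hd : (0 < d)%N) k0 M n :
  (forall w i, 0 <= tnth (U w) i < 1) -> (0 < n)%N ->
  chain_event k0 M `<=` \bigcup_p occupied Psi (@mesh_shell R d n M k0 p).
Proof.
move=> U01 n0 w [z [zP z1 zM]].
have [x [k [zk xinj xPsi x0 [xdec xle]]]] := chain_self_avoiding _ _ _ zP.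
have kk : k 0%N = k0 by apply: (@lattice_point_inj (U w)); rewrite /= -zk.
rewrite -x0 in zM.
have [p pP] := chain_in_mesh_shells hd _ _ _ _ _ n0 (U01 w) zM xdec xle.
rewrite kk in pP; exists p => //.
exists [tuple x l | l < n]; split; last by move=> l; rewrite tnth_mktuple.
split; last by move=> l; rewrite tnth_mktuple; exact: xPsi.
rewrite map_inj_uniq ?enum_uniq// => i j /xinj; exact: val_inj.
Qed.

Lemma card_mesh_index n M : #|{: {ffun 'I_d -> 'I_(n * d)} *
    {ffun 'I_n -> {ffun 'I_d -> 'I_(M.*2.*2.+1)}} *
    {t : n.-tuple 'I_(n * M).+1 | sorted leq (map val t)}}| =
  ((n * d) ^ d * ((M.*2.*2.+1) ^ d) ^ n * 'C(n + n * M, n))%N.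
Proof.
rewrite !card_prod !card_ffun !card_ord; congr (_ * _)%N.
by rewrite card_sig -card_sorted_tuples cardsE.
Qed.

(** Since [n ^ d <= (2 ^ d) ^ n] and the binomial coefficient is at most [(2 ^ M.+1) ^ n],
    everything but [d ^ d] is absorbed into an [n]-th power. *)
Lemma mesh_index_bound M n V :
  ((n * d) ^ d * V ^ n * 'C(n + n * M, n) <=
   d ^ d * (2 ^ d * V * 2 ^ M.+1) ^ n)%N.
Proof.
rewrite !expnMn [(n ^ d * _)%N]mulnC -!mulnA leq_mul//.
apply: leq_mul; last apply: leq_mul => //.
  rewrite -expnM mulnC expnM; case: (posnP d) => [->//|d0].
  by rewrite leq_exp2r//; apply/ltnW/ltn_expl.
by apply: leq_trans (bin_le_exp2 _ _) _; rewrite -expnM mulSn (mulnC M).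
Qed.

(** Union bound over the mesh codes. The measurable superset [E] stands in for [chain_event], whose
    measurability is not established. *)
Lemma chain_event_le (hd : (0 < d)%N) (k0 : d.-tuple int) (M n : nat)
    (A c theta : R) (rho : n.-tuple (d.-tuple R) -> \bar R) :
  (forall w i, 0 <= tnth (U w) i < 1) -> (0 < n)%N -> 0 < c -> 0 < A ->
  (forall p (l : 'I_n),
    (lebesgue_Rd R d (@mesh_shell R d n M k0 p l) <= (A / n%:R)%:E)%E) ->
  correlation_function Psi rho ->
  (forall x, (rho x <= (n%:R `^ (theta * n%:R) * c ^+ n)%:E)%E) ->
  exists2 E, measurable E /\ chain_event k0 M `<=` E &
    (P E <= (d%:R ^+ d * ((2 ^ d * (M.*2.*2.+1) ^ d * 2 ^ M.+1)%:R * c * A *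
              (n%:R `^ theta / n%:R)) ^+ n)%:E)%E.
Proof.
move=> U01 n0 c0 A0 shellA corr rhoK.
exists (\bigcup_p occupied Psi (@mesh_shell R d n M k0 p)).
  split; last exact: chain_event_sub_occupied.
  apply: fin_bigcup_measurable => // p _.
  by apply: measurable_occupied => l; exact: measurable_mesh_shell.
have occ p : (P (occupied Psi (@mesh_shell R d n M k0 p)) <=
    (n%:R `^ (theta * n%:R) * c ^+ n * (A / n%:R) ^+ n)%:E)%E.
  apply: (occupied_le _ _ _ _ _ corr rhoK) => // [|l].
    by rewrite mulr_ge0 ?powR_ge0// exprn_ge0// ltW.
  exact: measurable_mesh_shell.
apply: le_trans (measure_fin_bigcup_le _ _ occ) _.
  by move=> p; apply: measurable_occupied => l; exact: measurable_mesh_shell.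
rewrite lee_fin card_mesh_index powRrM powR_mulrn ?powR_ge0//.
set Q := n%:R `^ theta.
have Q0 : 0 <= Q by exact: powR_ge0.
have -> : Q ^+ n * c ^+ n * (A / n%:R) ^+ n = (c * A * (Q / n%:R)) ^+ n.
  by rewrite -!exprMn; congr (_ ^+ n); ring.
have -> : (2 ^ d * (M.*2.*2.+1) ^ d * 2 ^ M.+1)%:R * c * A * (Q / n%:R) =
  (2 ^ d * (M.*2.*2.+1) ^ d * 2 ^ M.+1)%:R * (c * A * (Q / n%:R)) by rewrite !mulrA.
rewrite [in leRHS]exprMn [leRHS]mulrA -!natrX -natrM ler_wpM2r//.
  by rewrite exprn_ge0// !mulr_ge0// ?invr_ge0// ltW.
by rewrite ler_nat mesh_index_bound.
Qed.

Lemma chain_event_negligible (hd : (0 < d)%N) (k0 : d.-tuple int) (M : nat)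
    (c theta : R) :
  (forall w i, 0 <= tnth (U w) i < 1) -> 0 < c -> theta < 1 ->
  (forall n : nat, (0 < n)%N -> exists rho : n.-tuple (d.-tuple R) -> \bar R,
     correlation_function Psi rho /\
     forall x, (rho x <= (n%:R `^ (theta * n%:R) * c ^+ n)%:E)%E) ->
  P.-negligible (chain_event k0 M).
Proof.
move=> U01 c0 t1 hrho.
have [A [A0 shellA]] := mesh_shell_measure_le (R := R) hd M.
set H := (2 ^ d * (M.*2.*2.+1) ^ d * 2 ^ M.+1)%:R * c * A.
have H0 : 0 < H by rewrite !mulr_gt0// ltr0n !muln_gt0 !expn_gt0.
have /choice[E EP] : forall n, exists E : set Omega, (0 < n)%N ->
    [/\ measurable E, chain_event k0 M `<=` E &
    (P E <= (d%:R ^+ d * (H * (n%:R `^ theta / n%:R)) ^+ n)%:E)%E].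
  move=> n; have [n0|] := boolP (0 < n)%N; last by exists set0.
  have [rho [corr rhoK]] := hrho n n0.
  have [E [mE sE] PE] :=
    chain_event_le hd k0 M n A c theta rho U01 n0 c0 A0 (shellA n n0 k0) corr rhoK.
  by exists E => _; split.
have mI : measurable (\bigcap_n E n.+1).
  by apply: bigcapT_measurable => n; have [] := EP n.+1 isT.
exists (\bigcap_n E n.+1); split => //; last first.
  by move=> w hw n _; have [_ + _] := EP n.+1 isT; apply.
apply/eqP; rewrite eq_le measure_ge0 andbT.
apply/lee_addgt0Pr => eps eps0; rewrite add0e.
have D0 : 0 < d%:R ^+ d :> R by rewrite exprn_gt0// ltr0n.
(* The minimum with 1 gives [q ^ n <= q], so for each [eps] a single suitable [n] suffices. *)
pose tau := Num.min 1 (eps / d%:R ^+ d).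
have tau0 : 0 < tau by rewrite lt_min ltr01 divr_gt0.
have [n [n0 nP]] := powR_sublinear theta H tau t1 H0 tau0.
have [mE _ PE] := EP n n0.
apply: (@le_trans _ _ (P (E n))).
  by apply: le_measure; rewrite ?inE//; move=> w /(_ n.-1 I); rewrite prednK.
apply: le_trans PE _; rewrite lee_fin.
have q0 : 0 <= H * (n%:R `^ theta / n%:R).
  by rewrite mulr_ge0 ?divr_ge0 ?powR_ge0// ltW.
set q := H * _ in nP q0 *.
have q1 : q <= 1 by apply: le_trans nP _; rewrite ge_min lexx.
have qe : q <= eps / d%:R ^+ d by apply: le_trans nP _; rewrite ge_min lexx orbT.
apply: (@le_trans _ _ (d%:R ^+ d * q)).
  by rewrite ler_pM2l// -[leRHS]expr1 ler_wiXn2l.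
by rewrite mulrC -ler_pdivlMr.
Qed.

End first_moment.

Theorem theorem3p4 (R : realType) (d : nat) (hd : (0 < d)%N)
    (dO : measure_display) (Omega : measurableType dO)
    (P : probability Omega R)
    (Psi : {RV P >-> configuration R d}) (U : {RV P >-> d.-tuple R})
    (hPsi : point_process Psi) (hstat : stationary Psi)
    (hU : forall (w : Omega) (i : 'I_d), 0 <= tnth (U w) i < 1)
    (hindep : independent_RV U Psi)
    (hcorr : exists c theta : R, 0 < c /\ 0 <= theta < 1 /\
       forall n : nat, (0 < n)%N ->
         exists rho : n.-tuple (d.-tuple R) -> \bar R,
           correlation_function Psi rho /\
           forall x, (rho x <= (n%:R `^ (theta * n%:R) * c ^+ n)%:E)%E) :
  {ae P, forall w, ~ exists z : nat -> d.-tuple R,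
     infinite_descending_chain (shifted_lattice (U w)) (Psi w) z}.
Proof.
have [c [theta [c0 [/andP[_ t1] hrho]]]] := hcorr.
(* Pairs of a starting point and an integer bound on the first distance are countable, and every
   chain has such a pair. *)
pose F i := if @unpickle (d.-tuple int * nat)%type i is Some (k0, M)
  then chain_event Psi U k0 M else set0.
apply: (@negligibleS _ _ _ _ (\bigcup_i F i)); last first.
  apply: negligible_bigcup => i; rewrite /F; case: unpickle => [[k0 M]|].
    exact: (chain_event_negligible _ _ hd k0 M c theta).
  exact: negligible_set0.
move=> w /= /contrapT[z zP].
have [k0 z1] := chain_lattice _ _ _ zP 1%N isT.
pose M := (Num.truncn (edist (z 2%N) (z 1%N))).+1.
exists (pickle (k0, M)) => //; rewrite /F pickleK; exists z; split => //.
exact/ltW/truncnS_gt.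
Qed.
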